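(* Let $\varepsilon>0$ and let $(\mathcal{T}_j)$ be a transgressive sequence at exponent $\varepsilon$. Write $\mathcal{T}_j=(a_j,b_j,c_j)$, $s_j=\min\{a_j,b_j\}$, $K_j=(a_j+b_j)/2$ and $\theta_\varepsilon=\varepsilon/(1+\varepsilon)$. Then $(\mathcal{T}_j)$ contains a subsequence falling into exactly one of the following two mutually exclusive regimes. (1) (Bounded smaller summand.) There is a fixed odd integer $s_0$ such that $s_j=s_0$ along the subsequence. The triples of the subsequence, up to interchanging $a_j$ and $b_j$, lie on the line $\{(s_0,2K-s_0,2K):K>s_0,\ \gcd(s_0,2K)=1\}$, with $K_j\to\infty$, and $$\log\left(\frac{2K_j-s_0}{\mathrm{rad}(2K_j-s_0)}\right)\ \ge\ t^{\mathcal K}(\mathcal{T}_j)+\theta_\varepsilon\log(2K_j)+\log\mathrm{rad}(s_0).$$ (2) (Unbounded smaller summand.) One has $s_j\to\infty$ along the subsequence, and $$\delta_{\mathrm{lin}}(\mathcal{T}_j)-t^{\mathcal K}(\mathcal{T}_j)-\theta_\varepsilon\log(2K_j)\ \ge\ \log s_j\ \longrightarrow\ \infty.$$ If moreover $s_j\ge K_j^{\alpha}$ for a fixed $\alpha\in(0,1]$ with $\theta_\varepsilon+\alpha<1$, then, with $\varepsilon'>0$ defined by $\theta_{\varepsilon'}=\varepsilon'/(1+\varepsilon')=\theta_\varepsilon+\alpha$, the subsequence satisfies $$\delta_{\mathrm{lin}}(\mathcal{T}_j)\ \ge\ t^{\mathcal K}(\mathcal{T}_j)+\theta_{\varepsilon'}\log(2K_j)-\log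 2 .$$
   Context: A parity-class triple is a triple $\mathcal{T}=(a,b,c)$ of pairwise coprime positive integers with $a+b=c$, $a$ and $b$ odd, and $c$ even; put $K=(a+b)/2$, so $c=2K$. $\mathrm{rad}(n)$ is the product of the distinct primes dividing $n$. The radical excess is $E_\varepsilon(\mathcal{T})=\log c-(1+\varepsilon)\log\mathrm{rad}(abc)$. A transgressive sequence at exponent $\varepsilon>0$ is an infinite sequence of distinct parity-class triples $\mathcal{T}_j$ with $E_\varepsilon(\mathcal{T}_j)\ge0$ for every $j$. The linear defect is $\delta_{\mathrm{lin}}(\mathcal{T})=\log\bigl(ab/(\mathrm{rad}(a)\mathrm{rad}(b))\bigr)$, and $t^{\mathcal K}(\mathcal{T})=\log\prod_{p\mid K,\ p\text{ odd prime}}p$. *)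

(* Defs.v *)
From HB Require Import structures.
From mathcomp Require Import all_boot all_order all_algebra.
From mathcomp Require Import all_classical all_reals all_analysis.

Set Implicit Arguments.
Unset Strict Implicit.
Unset Printing Implicit Defensive.

Import Order.TTheory GRing.Theory Num.Theory.
Import numFieldNormedType.Exports.

Local Open Scope classical_set_scope.
Local Open Scope ring_scope.

Definition rad (n : nat) : nat := (\prod_(p <- primes n) p)%N.

(* Raw triples; the arithmetic conditions are in [parity_class], so that
   equality of triples is equality of the three integers. *)
Record triple := Triple { sum_a : nat; sum_b : nat; sum_c : nat }.

Definition parity_class (T : triple) : Prop :=
  let: Triple a b c := T in
  [/\ [/\ (0 < a)%N, (0 < b)%N & (0 < c)%N],
      [/\ coprime a b, coprime a c & coprime b c],
      (a + b = c)%N &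
      [/\ odd a, odd b & ~~ odd c]].

(* An exact half for parity-class triples, as a + b is then even. *)
Definition half_sum (T : triple) : nat := (sum_a T + sum_b T)./2.

Definition min_summand (T : triple) : nat := minn (sum_a T) (sum_b T).

Definition swap (T : triple) : triple := Triple (sum_b T) (sum_a T) (sum_c T).

(* The subtraction is on nat, but never truncates since s0 < K. *)
Definition line (s0 : nat) : set triple :=
  [set Triple s0 (2 * K - s0)%N (2 * K)%N |
     K in [set K : nat | (s0 < K)%N /\ coprime s0 (2 * K)]].

Section RealQuantities.
Variable R : realType.
Implicit Types (eps : R) (T : triple) (U : nat -> triple).

Definition theta eps : R := eps / (1 + eps).

Definition radical_excess eps T : R :=
  ln (sum_c T)%:R - (1 + eps) * ln (rad (sum_a T * sum_b T * sum_c T))%:R.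

Definition linear_defect T : R :=
  ln ((sum_a T * sum_b T)%:R / (rad (sum_a T) * rad (sum_b T))%:R).

Definition tK T : R := ln (\prod_(p <- primes (half_sum T) | odd p) p)%N%:R.

Definition transgressive eps U : Prop :=
  [/\ forall j, parity_class (U j),
      injective U &
      forall j, 0 <= radical_excess eps (U j)].

Definition bounded_smaller_summand U : Prop :=
  exists2 s0, odd s0 & forall j, min_summand (U j) = s0.

Definition unbounded_smaller_summand U : Prop :=
  min_summand (U j) @[j --> \oo] --> \oo.

Definition bounded_regime eps U : Prop :=
  exists s0 : nat,
    [/\ odd s0,
        forall j, min_summand (U j) = s0,
        forall j, line s0 (U j) \/ line s0 (swap (U j)),
        half_sum (U j) @[j --> \oo] --> \oo &
        forall j,
          tK (U j) + theta eps * ln (2 * half_sum (U j))%:R + ln (rad s0)%:R <=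
          ln ((2 * half_sum (U j) - s0)%N%:R /
              (rad (2 * half_sum (U j) - s0))%:R)].

Definition unbounded_regime eps U : Prop :=
  [/\ unbounded_smaller_summand U,
      forall j,
        ln (min_summand (U j))%:R <=
        linear_defect (U j) - tK (U j) - theta eps * ln (2 * half_sum (U j))%:R,
      ln (min_summand (U j))%:R @[j --> \oo] --> (+oo : set_system R) &
      forall alpha : R, 0 < alpha <= 1 -> theta eps + alpha < 1 ->
        (forall j, (half_sum (U j))%:R `^ alpha <= (min_summand (U j))%:R) ->
        exists eps' : R,
          [/\ 0 < eps',
              theta eps' = theta eps + alpha &
              forall j,
                tK (U j) + theta eps' * ln (2 * half_sum (U j))%:R - ln 2 <=
                linear_defect (U j)]].

End RealQuantities.

(* Main.v *)
From mathcomp Require Import all_boot all_order all_algebra.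
From mathcomp Require Import all_classical all_reals all_analysis.
From mathcomp Require Import zify ring lra.
Require Import Defs.

Set Implicit Arguments.
Unset Strict Implicit.
Unset Printing Implicit Defensive.

Import Order.TTheory GRing.Theory Num.Theory.
Import numFieldNormedType.Exports.

Local Open Scope classical_set_scope.
Local Open Scope ring_scope.

(** Write [s] for the smaller summand, so that the larger one is [2K - s >= K].

    The defect inequality comes from a single computation.  The summands and
    [c = 2K] being coprime, [rad (abc) = rad a * rad b * rad (2K)], and
    [rad (2K)] is twice the product of the odd primes of [K].  Nonnegative
    radical excess says [ln (rad (abc)) <= (1 - theta) ln (2K)], hence
      [linear_defect >= ln (2ab) + tK - (1 - theta) ln (2K)].
    The factor 2 is exactly what is lost in [ab = s (2K - s) >= s K], whence
    [linear_defect >= ln s + tK + theta ln (2K)] ([ln_min_summand_le_defect]).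
    The inequality of the bounded regime is this one after removing the
    contribution [ln (s / rad s)] of the smaller summand from the linear defect,
    and the inequality with the exponent [alpha] follows from
    [ln s >= alpha ln K = alpha ln (2K) - alpha ln 2].

    The dichotomy is the pigeonhole principle for the integer sequence [s_j]
    ([cvg_nat_or_constant_subseq]): either some value is taken infinitely often,
    or every value is taken finitely often and then the whole sequence tends to
    infinity.  In the first case [K_j] tends to infinity, since a parity-class
    triple is determined by [K] and its first summand, which is at most [2K]. *)

(** * Sequences of natural numbers tending to infinity *)

Lemma finite_nat_set_bounded (A : set nat) :
  finite_set A -> exists N, forall n, A n -> (n < N)%N.
Proof.
move=> /finite_seqP[s ->]; exists (\max_(i <- s) i).+1 => n /= ns.
by rewrite ltnS; exact: leq_bigmax_seq.
Qed.

Lemma finite_fibres_cvg_nat (f : nat -> nat) :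
  (forall n, finite_set (f @^-1` [set n])) -> f j @[j --> \oo] --> \oo.
Proof.
move=> fibf; apply/cvgnyPge => M.
have : finite_set (\bigcup_(n in `I_M) (f @^-1` [set n])).
  by apply: bigcup_finite => // n _; exact: fibf.
move=> /finite_nat_set_bounded[N small_lt].
exists N => // j /= Nj; rewrite leqNgt; apply/negP => fjM.
by have := small_lt j; rewrite ltnNge Nj => /(_ _)/notF; apply; exists (f j).
Qed.

Lemma cvg_nat_or_constant_subseq (f : nat -> nat) :
  f j @[j --> \oo] --> \oo \/
  exists (s : nat) (phi : nat -> nat),
    {homo phi : i j / (i < j)%N} /\ forall j, f (phi j) = s.
Proof.
have [fibf|/existsNP[s inf_s]] :=
  pselect (forall n, finite_set (f @^-1` [set n])).
  by left; exact: finite_fibres_cvg_nat.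
right; exists s.
have initial_finite (n : nat) : finite_set [set y : nat | (y <= n)%O].
  by apply: sub_finite_set (finite_II n.+1) => y.
have [phi [phi_mono _ phiP]] :=
  infinite_increasing_seq_wf initial_finite inf_s 0%N.
by exists phi; split=> // i j; rewrite !ltnNge -!leEnat phi_mono.
Qed.

Lemma ln_natr_cvg (R : realType) (f : nat -> nat) :
  f j @[j --> \oo] --> \oo -> ln (f j)%:R @[j --> \oo] --> (+oo : set_system R).
Proof.
move=> /cvgnyPge f_oo; apply/cvgryPge => A.
apply: filterS (f_oo (Num.truncn (expR A)).+1) => j fj.
have expA_le : expR A <= (f j)%:R :> R.
  by apply: ltW; apply: lt_le_trans (truncnS_gt _) _; rewrite ler_nat.
by rewrite -ler_expR lnK // posrE (lt_le_trans (expR_gt0 _) expA_le).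
Qed.

(** * Radicals *)

Lemma rad_gt0 (n : nat) : (0 < rad n)%N.
Proof.
rewrite /rad big_seq; elim/big_ind: _ => // [x y x0 y0|p].
  by rewrite muln_gt0 x0.
by rewrite mem_primes => /andP[/prime_gt0].
Qed.

Lemma rad_coprimeM (m n : nat) : (0 < m)%N -> (0 < n)%N -> coprime m n ->
  rad (m * n) = (rad m * rad n)%N.
Proof.
move=> m0 n0 mn; rewrite /rad -big_cat /=; apply: perm_big.
apply: uniq_perm; first exact: primes_uniq.
  by rewrite cat_uniq !primes_uniq andbT -coprime_has_primes.
by move=> p; rewrite primesM // mem_cat.
Qed.

Lemma rad_double (K : nat) : (0 < K)%N ->
  rad (2 * K) = (2 * \prod_(p <- primes K | odd p) p)%N.
Proof.
move=> K0; rewrite /rad -[in RHS]big_filter.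
have <- : (\prod_(p <- 2%N :: [seq p <- primes K | odd p]) p =
    2 * \prod_(p <- [seq p <- primes K | odd p]) p)%N by rewrite big_cons.
apply: perm_big; apply: uniq_perm; first exact: primes_uniq.
  by rewrite cons_uniq mem_filter filter_uniq ?primes_uniq.
move=> p; rewrite primesM // [in RHS]in_cons mem_filter.
rewrite [primes 2]/= inE; have [//|p2] /= := eqVneq p 2%N.
have [pK|] := boolP (p \in primes K); last by rewrite andbF.
by move: pK; rewrite mem_primes => /andP[/even_prime[/eqP|->]]; rewrite ?(negPf p2).
Qed.

(** * The arithmetic of a parity-class triple *)

Section ParityClass.
Variable T : triple.
Hypothesis T_parity : parity_class T.

Let s := min_summand T.
Let K := half_sum T.

Lemma sum_c_double : sum_c T = (2 * K)%N.
Proof.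
rewrite /K; case: T T_parity => a b c [_ _ <- [oa ob _]] /=.
by rewrite /half_sum /= mul2n even_halfK // oddD oa ob.
Qed.

Lemma summands_gt0 : (0 < sum_a T)%N /\ (0 < sum_b T)%N.
Proof. by case: T T_parity => a b c [[]]. Qed.

Lemma sum_summands : (sum_a T + sum_b T = 2 * K)%N.
Proof. by rewrite -sum_c_double; case: T T_parity => a b c []. Qed.

Lemma min_summand_gt0 : (0 < s)%N.
Proof. by rewrite leq_min; case: summands_gt0 => -> ->. Qed.

Lemma min_summand_le_half : (s <= K)%N.
Proof. by have := sum_summands; rewrite /s /min_summand; lia. Qed.

Lemma odd_min_summand : odd s.
Proof.
rewrite /s /min_summand /minn.
by case: T T_parity => a b c [_ _ _ [oa ob _]] /=; case: ifP.
Qed.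

Lemma half_sum_gt0 : (0 < K)%N.
Proof. exact: leq_trans min_summand_gt0 min_summand_le_half. Qed.

Lemma summands_min_max :
  sum_a T = s /\ sum_b T = (2 * K - s)%N \/
  sum_b T = s /\ sum_a T = (2 * K - s)%N.
Proof. by have := sum_summands; rewrite /s /min_summand; lia. Qed.

Lemma line_or_swap : (s < K)%N -> line s T \/ line s (swap T).
Proof.
move=> sK; have := summands_min_max; have := sum_c_double.
rewrite -/s -/K /swap.
case: T T_parity => a b c [_ [_ ac bc] _ _] /= cE.
by case=> -[aE bE]; [left|right];
  exists K; rewrite /= ?aE ?bE ?cE //; split=> //; rewrite -?aE -?cE.
Qed.

(** Coprime summands agree only in the triple [(1, 1, 2)], where
    [rad (abc) = c], so that the excess is [- eps * ln 2 < 0]. *)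
Lemma min_summand_lt_half (R : realType) (eps : R) :
  0 < eps -> 0 <= radical_excess eps T -> (s < K)%N.
Proof.
move=> eps0; have := min_summand_le_half; rewrite leq_eqVlt => /orP[/eqP sK|//].
have a1 : sum_a T = 1%N /\ sum_b T = 1%N.
  have : sum_a T = sum_b T by have := summands_min_max; lia.
  case: T T_parity => a b c [_ [+ _ _] _ _] /= eab.
  by rewrite -eab /coprime gcdnn => /eqP ->.
have c2 : sum_c T = 2%N by have := sum_summands; rewrite sum_c_double; lia.
rewrite /radical_excess c2 (proj1 a1) (proj2 a1).
have -> : rad (1 * 1 * 2) = 2%N by rewrite /rad /= big_seq1.
have : 0 < ln 2 :> R by rewrite ln_gt0 // ltr1n.
by nra.
Qed.

Section Defect.
Variable R : realType.

Let lnM_nat (m n : nat) : (0 < m)%N -> (0 < n)%N ->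
  ln (m * n)%:R = ln m%:R + ln n%:R :> R.
Proof. by move=> m0 n0; rewrite natrM lnM // posrE ltr0n. Qed.

Let ln_div_nat (m n : nat) : (0 < m)%N -> (0 < n)%N ->
  ln (m%:R / n%:R) = ln m%:R - ln n%:R :> R.
Proof. by move=> m0 n0; rewrite ln_div // posrE ltr0n. Qed.

Let ler_ln_nat (m n : nat) : (0 < m)%N -> (m <= n)%N ->
  ln m%:R <= ln n%:R :> R.
Proof.
by move=> m0 mn; rewrite ler_ln ?ler_nat // posrE ltr0n // (leq_trans m0).
Qed.

Lemma max_summand_gt0 : (0 < 2 * K - s)%N.
Proof. by have := half_sum_gt0; have := min_summand_le_half; lia. Qed.

Lemma linear_defect_split : linear_defect R T =
  ln s%:R - ln (rad s)%:R + ln ((2 * K - s)%N%:R / (rad (2 * K - s))%:R).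
Proof.
have [abE radE] : (sum_a T * sum_b T = s * (2 * K - s))%N /\
    (rad (sum_a T) * rad (sum_b T) = rad s * rad (2 * K - s))%N.
  by case: summands_min_max => -[-> ->]; split=> //; exact: mulnC.
rewrite /linear_defect abE radE.
have s0 := min_summand_gt0; have m0 := max_summand_gt0.
rewrite !ln_div_nat ?muln_gt0 ?s0 ?m0 ?rad_gt0 // !lnM_nat ?rad_gt0 //.
by ring.
Qed.

Lemma ln_rad_triple :
  ln (rad (sum_a T * sum_b T * sum_c T))%:R =
  ln (rad s)%:R + ln (rad (2 * K - s))%:R + (ln 2 + tK R T) :> R.
Proof.
have K0 := half_sum_gt0.
have radT : (rad (sum_a T * sum_b T * sum_c T) =
    rad s * rad (2 * K - s) * rad (2 * K))%N.
  rewrite -sum_c_double.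
  have -> : (rad s * rad (sum_c T - s) = rad (sum_a T) * rad (sum_b T))%N.
    by rewrite sum_c_double; case: summands_min_max => -[-> ->] //; rewrite mulnC.
  case: T T_parity => a b c [[a0 b0 c0] [ab ac bc] _ _] /=.
  by rewrite !rad_coprimeM ?muln_gt0 ?a0 // coprimeMl ac.
rewrite radT !lnM_nat ?muln_gt0 ?rad_gt0 // rad_double // lnM_nat //.
by have := rad_gt0 (2 * K); rewrite rad_double // muln_gt0.
Qed.

(** The bound is free of constants because the prime 2 of [c] enters
    [rad (abc)]: the resulting [ln 2] makes up for the larger summand being
    possibly as small as [c / 2]. *)
Lemma ln_min_summand_le_defect (eps : R) :
  0 < eps -> 0 <= radical_excess eps T ->
  ln s%:R + tK R T + theta eps * ln (2 * K)%:R <= linear_defect R T.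
Proof.
move=> eps0; rewrite /radical_excess linear_defect_split ln_rad_triple.
rewrite sum_c_double ln_div_nat ?max_summand_gt0 ?rad_gt0 //.
set ra := ln (rad s)%:R; set rb := ln (rad _)%:R; set L := ln (2 * K)%:R.
have max_ge : L <= ln 2 + ln (2 * K - s)%:R.
  have := half_sum_gt0; have := min_summand_le_half => sK K0.
  rewrite -(lnM_nat _ max_summand_gt0) //; apply: ler_ln_nat; first by lia.
  by lia.
have thetaE : theta eps * (1 + eps) = eps.
  by rewrite /theta divfK // gt_eqF // ltr_wpDl // ler01.
move=> excess.
have : ra + rb + (ln 2 + tK R T) <= (1 - theta eps) * L.
  have -> : 1 - theta eps = (1 + eps)^-1.
    by rewrite /theta; field; rewrite gt_eqF // ltr_wpDl // ler01.
  by rewrite ler_pdivlMl ?ltr_wpDl ?ler01 // -subr_ge0.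
by lra.
Qed.

(** The hypothesis [s >= K ^ alpha] turns [ln s] into [alpha ln (2K)] at the
    cost [alpha ln 2 <= ln 2], which raises [theta eps] by [alpha]. *)
Lemma defect_ge_of_large_min_summand (eps alpha tau : R) :
  0 < eps -> 0 <= radical_excess eps T -> 0 < alpha <= 1 ->
  tau = theta eps + alpha -> K%:R `^ alpha <= s%:R ->
  tK R T + tau * ln (2 * K)%:R - ln 2 <= linear_defect R T.
Proof.
move=> eps0 excess /andP[alpha0 alpha1] -> powK.
have := ln_min_summand_le_defect eps0 excess.
have K0 : 0 < K%:R :> R by rewrite ltr0n half_sum_gt0.
have : alpha * ln K%:R <= ln s%:R.
  by rewrite -ln_powR ler_ln // posrE ?powR_gt0 // ltr0n min_summand_gt0.
rewrite !lnM_nat ?half_sum_gt0 //.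
have : 0 < ln 2 :> R by rewrite ln_gt0 // ltr1n.
by nra.
Qed.

End Defect.
End ParityClass.

(** * The two regimes of a transgressive sequence *)

(** A parity-class triple is determined by [K] and its first summand, which is
    at most [2K], so each value of [K] is taken finitely often. *)
Lemma half_sum_cvg (U : nat -> triple) :
  (forall j, parity_class (U j)) -> injective U ->
  half_sum (U j) @[j --> \oo] --> \oo.
Proof.
move=> U_parity U_inj; apply: finite_fibres_cvg_nat => k.
pose with_half_sum a := Triple a (2 * k - a)%N (2 * k)%N.
apply: (@sub_finite_set _ _ (U @^-1` (with_half_sum @` `I_(2 * k).+1))).
  move=> j /= Uk; move: (sum_summands (U_parity j)) (sum_c_double (U_parity j)).
  rewrite Uk; case: (U j) => a b c /= abE ->; exists a => /=; first by lia.
  by rewrite /with_half_sum -abE addKn.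
apply: finite_preimage; last exact/finite_image/finite_II.
by move=> i j _ _; exact: U_inj.
Qed.

Lemma regimes_exclusive (U : nat -> triple) :
  ~ (bounded_smaller_summand U /\ unbounded_smaller_summand U).
Proof.
move=> [[s _ sE]] /cvgnyPgt/(_ s)[N _ /(_ N (leqnn N))] /=.
by rewrite sE ltnn.
Qed.

Section Regimes.
Variables (R : realType) (eps : R) (U : nat -> triple).
Hypotheses (eps0 : 0 < eps) (U_trans : transgressive eps U).

Lemma transgressive_subseq (phi : nat -> nat) :
  {homo phi : i j / (i < j)%N} -> transgressive eps (U \o phi).
Proof.
case: U_trans => U_parity U_inj U_excess phi_mono.
split=> [j||j] /=; [exact: U_parity | | exact: U_excess].
by apply: inj_comp => //; apply: inc_inj; exact: leq_mono.
Qed.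

Lemma bounded_regime_of_constant (s : nat) :
  (forall j, min_summand (U j) = s) -> bounded_regime eps U.
Proof.
case: U_trans => U_parity U_inj U_excess sE; exists s.
split=> // [|j||j].
- by rewrite -(sE 0%N); exact: odd_min_summand.
- by rewrite -(sE j); apply: line_or_swap => //; exact: min_summand_lt_half eps0 _.
- exact: half_sum_cvg.
- have := ln_min_summand_le_defect (U_parity j) eps0 (U_excess j).
  by rewrite linear_defect_split // sE; lra.
Qed.

Lemma unbounded_regime_of_cvg :
  unbounded_smaller_summand U -> unbounded_regime eps U.
Proof.
case: U_trans => U_parity U_inj U_excess s_oo; split=> //.
- move=> j; have := ln_min_summand_le_defect (U_parity j) eps0 (U_excess j).
  by lra.
- exact: ln_natr_cvg.
move=> alpha alpha01 tau_lt1 powK; set tau := theta eps + alpha in tau_lt1 *.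
have tau0 : 0 < tau.
  by rewrite addr_gt0 ?divr_gt0 ?addr_gt0 //; case/andP: alpha01.
(* The inverse of [theta] is [tau |-> tau / (1 - tau)]. *)
have theta_inv : theta (tau / (1 - tau)) = tau.
  by rewrite /theta; field; lra.
exists (tau / (1 - tau)); split=> // [|j]; first by rewrite divr_gt0 // subr_gt0.
rewrite theta_inv.
exact: (defect_ge_of_large_min_summand (U_parity j) eps0 (U_excess j) alpha01 erefl).
Qed.

End Regimes.

Theorem theorem10p5 (R : realType) (eps : R) (T : nat -> triple) :
  0 < eps -> transgressive eps T ->
  (forall phi : nat -> nat, {homo phi : i j / (i < j)%N} ->
     ~ (bounded_smaller_summand (T \o phi) /\
        unbounded_smaller_summand (T \o phi))) /\
  exists2 phi : nat -> nat, {homo phi : i j / (i < j)%N} &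
    (bounded_regime eps (T \o phi) /\ ~ unbounded_regime eps (T \o phi)) \/
    (unbounded_regime eps (T \o phi) /\ ~ bounded_regime eps (T \o phi)).
Proof.
move=> eps0 T_trans.
split=> [phi _|]; first exact: regimes_exclusive.
have not_both U : ~ (bounded_regime eps U /\ unbounded_regime eps U).
  move=> [[s [s_odd sE _ _ _]] [s_oo _ _ _]].
  by apply: (@regimes_exclusive U); split=> //; exists s.
have [s_oo|[s [phi [phi_mono sE]]]] :=
  cvg_nat_or_constant_subseq (min_summand \o T).
- have regime : unbounded_regime eps T by exact: unbounded_regime_of_cvg.
  by exists id => //; right; split=> // bd; exact: (not_both T).
- have regime : bounded_regime eps (T \o phi).
    have subseq_trans := transgressive_subseq T_trans phi_mono.
    exact: (bounded_regime_of_constant eps0 subseq_trans sE).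
  by exists phi => //; left; split=> // unbd; exact: (not_both (T \o phi)).
Qed.
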